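(* The automorphism $\sigma$ of $\mathcal O$ and the antiautomorphism $\dagger$ of $\mathcal O$ fix every element of the center $\mathcal Z$ of $\mathcal O$.
   Context: $\mathbb F$ is a field of characteristic zero; all vector spaces and Lie algebras are over $\mathbb F$. $\mathbb F[t,t^{-1}]$ is the algebra of Laurent polynomials. $L(\mathfrak{gl}_2)=\mathfrak{gl}_2\otimes\mathbb F[t,t^{-1}]$ is the loop algebra, with Lie bracket $[u\otimes\varphi,v\otimes\phi]=[u,v]\otimes\varphi\phi$; its elements are viewed as $2\times 2$ matrices with entries in $\mathbb F[t,t^{-1}]$, with bracket $[x,y]=xy-yx$. For $x=\begin{pmatrix} a(t)&b(t)\\ c(t)&d(t)\end{pmatrix}\in L(\mathfrak{gl}_2)$ define $$\theta(x)=\begin{pmatrix} d(t^{-1})&c(t^{-1})\\ b(t^{-1})&a(t^{-1})\end{pmatrix},\quad \sigma(x)=\begin{pmatrix} d(t)&c(t)t\\ b(t)t^{-1}&a(t)\end{pmatrix},\quad \dagger(x)=\begin{pmatrix} a(t^{-1})&c(t^{-1})\\ b(t^{-1})&d(t^{-1})\end{pmatrix},$$ and $\varepsilon(x)=a(1)+d(1)\in\mathbb F$. An antiautomorphism of a Lie algebra $\mathfrak g$ is a vector space isomorphism $\alpha:\mathfrak g\to\mathfrak g$ with $\alpha([u,v])=[\alpha(v),\alpha(u)]$ for all $u,v$. The maps $\theta,\sigma$ are automorphisms and $\dagger$ is an antiautomorphism of $L(\mathfrak{gl}_2)$; they mutually commute, and $\varepsilon:L(\mathfrak{gl}_2)\to\mathbb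 F$ is a Lie algebra homomorphism ($\mathbb F$ abelian). Let $\mathcal L=\ker\varepsilon$, and let $\mathcal O$ be the Lie algebra of all elements of $\mathcal L$ fixed by $\theta$. $\mathcal O$ is invariant under $\sigma$ and $\dagger$, and the restrictions of $\sigma,\dagger$ to $\mathcal O$ are again denoted $\sigma,\dagger$. $\mathcal Z$ denotes the center of $\mathcal O$. *)

(* Defs.v *)
From HB Require Import structures.
From mathcomp Require Import all_boot all_order all_algebra.
From mathcomp Require Import finmap ring.
From mathcomp.multinomials Require Import monalg.

Set Implicit Arguments.
Unset Strict Implicit.
Unset Printing Implicit Defensive.

Import GRing.Theory.

Local Open Scope fset_scope.
Local Open Scope ring_scope.

(* Laurent polynomials F[t, t^-1]: finitely supported functions int -> F under
   convolution, p @_ k being the coefficient of t^k.  The product of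
   [{malg F[K]}] is not available at K = int, since a [monomType] has no
   non-trivial invertible element, so it is defined here. *)
Definition laurent (F : fieldType) : Type := {malg F[int]}.

HB.instance Definition _ (F : fieldType) := 
  GRing.Lmodule.copy (laurent F) {malg F[int]}.

Section Laurent.
Variable F : fieldType.
Implicit Types (p q r : laurent F) (c : F) (k n : int).

Definition lmon c n : laurent F := << c *g n >>.

Definition lmul p q : laurent F :=
  \sum_(i <- msupp p) \sum_(j <- msupp q) lmon (p@_i * q@_j) (i + j).

Lemma lmon0 n : lmon 0 n = 0. Proof. exact: monalgU0. Qed.
Lemma lmonD n : {morph lmon^~ n : c d / c + d}. Proof. exact: monalgUD. Qed.
Lemma coef_lmon c n k : (lmon c n)@_k = c *+ (n == k).
Proof. exact: mcoeffU. Qed.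
Lemma lmonE p : p = \sum_(i <- msupp p) lmon p@_i i.
Proof. exact: monalgE. Qed.
Lemma lmonZ c d n : c *: lmon d n = lmon (c * d) n.
Proof. by apply/malgP => k; rewrite mcoeffZ !coef_lmon mulrnAr. Qed.

Lemma lsum_ext (V : nmodType) (G : F -> int -> V) (d : {fset int}) p :
  (forall n, G 0 n = 0) -> msupp p `<=` d ->
  \sum_(i <- msupp p) G p@_i i = \sum_(i <- d) G p@_i i.
Proof.
move=> G0 le_pd; apply: big_fset_incl => // k _ /mcoeff_outdom ->.
exact: G0.
Qed.

Lemma lsumD (V : nmodType) (G : F -> int -> V) p q :
  (forall n, G 0 n = 0) -> (forall n, {morph G^~ n : c d / c + d}) ->
  \sum_(i <- msupp (p + q)) G (p + q)@_i i =
    \sum_(i <- msupp p) G p@_i i + \sum_(i <- msupp q) G q@_i i.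
Proof.
move=> G0 GD; rewrite (lsum_ext G0 (msuppD_le p q)).
rewrite (lsum_ext G0 (fsubsetUl (msupp p) (msupp q))).
rewrite (lsum_ext G0 (fsubsetUr (msupp p) (msupp q))) -big_split /=.
by apply: eq_bigr => i _; rewrite mcoeffD GD.
Qed.

Lemma lsum_mon (V : nmodType) (G : F -> int -> V) c n :
  (forall n, G 0 n = 0) ->
  \sum_(i <- msupp (lmon c n)) G (lmon c n)@_i i = G c n.
Proof.
move=> G0; rewrite (lsum_ext G0 (msuppU_le : msupp (lmon c n) `<=` [fset n])).
by rewrite big_seq_fset1 coef_lmon eqxx.
Qed.

Lemma lmulDl : left_distributive lmul +%R.
Proof.
move=> p q r; apply: (lsumD (G := fun c i => \sum_(j <- msupp r) lmon (c * r@_j) (i + j))).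
  by move=> n; apply: big1 => j _; rewrite mul0r lmon0.
move=> n c d; rewrite -big_split /=; apply: eq_bigr => j _.
by rewrite mulrDl lmonD.
Qed.

Lemma lmulC : commutative lmul.
Proof.
move=> p q; rewrite /lmul exchange_big /=; apply: eq_bigr => i _.
by apply: eq_bigr => j _; rewrite mulrC addrC.
Qed.

Lemma lmulDr : right_distributive lmul +%R.
Proof. by move=> p q r; rewrite lmulC lmulDl !(lmulC _ p). Qed.

Lemma lmul0r : left_zero 0 lmul.
Proof. by move=> p; rewrite /lmul msupp0 big_seq_fset0. Qed.

Lemma lmulr0 : right_zero 0 lmul.
Proof. by move=> p; rewrite lmulC lmul0r. Qed.

Lemma lmul_mon c d m n : lmul (lmon c m) (lmon d n) = lmon (c * d) (m + n).
Proof.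
rewrite /lmul (lsum_mon (G := fun a i =>
  \sum_(j <- msupp (lmon d n)) lmon (a * (lmon d n)@_j) (i + j))).
  by rewrite (lsum_mon (G := fun a j => lmon (c * a) (m + j))) // => k; rewrite mulr0 lmon0.
by move=> k; apply: big1 => j _; rewrite mul0r lmon0.
Qed.

Lemma laurent_ind (P : laurent F -> Prop) :
  P 0 -> (forall p q, P p -> P q -> P (p + q)) -> (forall c n, P (lmon c n)) ->
  forall p, P p.
Proof. by move=> P0 PD Pmon p; rewrite (lmonE p); apply: big_ind. Qed.

Lemma lmulA : associative lmul.
Proof.
move=> p q r; elim/laurent_ind: p => [|p p' IHp IHp'|c m].
- by rewrite !lmul0r.
- by rewrite !lmulDl IHp IHp'.
elim/laurent_ind: q => [|q q' IHq IHq'|d n].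
- by rewrite !(lmul0r, lmulr0).
- by rewrite !(lmulDl, lmulDr) IHq IHq'.
elim/laurent_ind: r => [|r r' IHr IHr'|e k].
- by rewrite !lmulr0.
- by rewrite !lmulDr IHr IHr'.
by rewrite !lmul_mon mulrA addrA.
Qed.

Lemma lmul1r : left_id (lmon 1 0) lmul.
Proof.
move=> p; elim/laurent_ind: p => [|p q IHp IHq|c n]; first by rewrite lmulr0.
  by rewrite lmulDr IHp IHq.
by rewrite lmul_mon mul1r add0r.
Qed.

Lemma lone_neq0 : lmon 1 0 != 0.
Proof. by rewrite monalgU_eq0 oner_eq0. Qed.

HB.instance Definition _ := GRing.Zmodule_isComNzRing.Build (laurent F)
  lmulA lmulC lmul1r lmulDl lone_neq0.

Lemma lscaleAl c p q : c *: (p * q) = (c *: p) * q.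
Proof.
have scaleE r : c *: r = lmon c 0 * r.
  elim/laurent_ind: r => [|r r' IHr IHr'|d n].
  - by rewrite scaler0 mulr0.
  - by rewrite scalerDr mulrDr IHr IHr'.
  - by rewrite lmonZ [RHS]lmul_mon add0r.
by rewrite !scaleE mulrA.
Qed.

HB.instance Definition _ :=
  GRing.Lmodule_isLalgebra.Build F (laurent F) lscaleAl.
HB.instance Definition _ := GRing.Lalgebra_isComAlgebra.Build F (laurent F).

(* t^n *)
Definition tpow n : laurent F := lmon 1 n.

Lemma tpow0 : tpow 0 = 1. Proof. by []. Qed.
Lemma tpowD m n : tpow (m + n) = tpow m * tpow n.
Proof. by rewrite [RHS]lmul_mon mulr1. Qed.

(* p(t^-1) *)
Definition linv p : laurent F := \sum_(k <- msupp p) lmon p@_k (- k).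

(* p(u), meaningful for u != 0 *)
Definition leval (u : F) p : F := \sum_(k <- msupp p) p@_k * u ^ k.

Lemma linv_mon c n : linv (lmon c n) = lmon c (- n).
Proof. by apply: (lsum_mon (G := fun a i => lmon a (- i))) => k; rewrite lmon0. Qed.

Lemma linvD : {morph linv : p q / p + q}.
Proof.
move=> p q; apply: (lsumD (G := fun a i => lmon a (- i))) => [n|n c d].
  by rewrite lmon0.
by rewrite lmonD.
Qed.

Lemma linv0 : linv 0 = 0. Proof. by rewrite /linv msupp0 big_seq_fset0. Qed.

Lemma linvZ c p : linv (c *: p) = c *: linv p.
Proof.
elim/laurent_ind: p => [|p q IHp IHq|d n].
- by rewrite !(scaler0, linv0).
- by rewrite scalerDr !linvD IHp IHq scalerDr.
- by rewrite lmonZ !linv_mon lmonZ.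
Qed.

Lemma linvM : {morph linv : p q / p * q}.
Proof.
move=> p q; elim/laurent_ind: p => [|p p' IHp IHp'|c m].
- by rewrite mul0r linv0 mul0r.
- by rewrite mulrDl !linvD IHp IHp' mulrDl.
elim/laurent_ind: q => [|q q' IHq IHq'|d n].
- by rewrite mulr0 linv0 mulr0.
- by rewrite mulrDr !linvD IHq IHq' mulrDr.
by rewrite [lmon c m * _]lmul_mon !linv_mon [RHS]lmul_mon opprD.
Qed.

Lemma linvK : involutive linv.
Proof.
move=> p; elim/laurent_ind: p => [|p q IHp IHq|c n]; first by rewrite !linv0.
  by rewrite !linvD IHp IHq.
by rewrite !linv_mon opprK.
Qed.

Lemma linv_tpow n : linv (tpow n) = tpow (- n). Proof. exact: linv_mon. Qed.

Lemma linvB : {morph linv : p q / p - q}.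
Proof. by move=> p q; rewrite linvD -scaleN1r linvZ scaleN1r. Qed.

Lemma leval_mon u c n : leval u (lmon c n) = c * u ^ n.
Proof. by apply: (lsum_mon (G := fun a i => a * u ^ i)) => k; rewrite mul0r. Qed.

Lemma levalD u : {morph leval u : p q / p + q}.
Proof.
move=> p q; apply: (lsumD (G := fun a i => a * u ^ i)) => [n|n c d].
  by rewrite mul0r.
by rewrite mulrDl.
Qed.

Lemma leval0 u : leval u 0 = 0. Proof. by rewrite /leval msupp0 big_seq_fset0. Qed.

Lemma levalZ u c p : leval u (c *: p) = c * leval u p.
Proof.
elim/laurent_ind: p => [|p q IHp IHq|d n].
- by rewrite scaler0 leval0 mulr0.
- by rewrite scalerDr !levalD IHp IHq mulrDr.
- by rewrite lmonZ !leval_mon mulrA.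
Qed.

Lemma levalB u : {morph leval u : p q / p - q}.
Proof. by move=> p q; rewrite levalD -scaleN1r levalZ mulN1r. Qed.

Lemma leval1_linv p : leval 1 (linv p) = leval 1 p.
Proof.
elim/laurent_ind: p => [|p q IHp IHq|d n]; first by rewrite linv0.
  by rewrite linvD !levalD IHp IHq.
by rewrite linv_mon !leval_mon !exp1rz.
Qed.

End Laurent.

HB.mixin Record Lmodule_isLieAlgebra (F : fieldType) V of GRing.Lmodule F V := {
  lie : V -> V -> V;
  lie_linearl : forall z (a : F) x y, lie (a *: x + y) z = a *: lie x z + lie y z;
  lie_linearr : forall z (a : F) x y, lie z (a *: x + y) = a *: lie z x + lie z y;
  liexx : forall x, lie x x = 0;
  lie_jacobi : forall x y z,
    lie x (lie y z) + lie y (lie z x) + lie z (lie x y) = 0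
}.

#[short(type="lieAlgType")]
HB.structure Definition LieAlgebra (F : fieldType) :=
  { V of GRing.Lmodule F V & Lmodule_isLieAlgebra F V }.

Section LieTheory.
Variables (F : fieldType) (g : lieAlgType F).

Definition lie_automorphism (alpha : g -> g) : Prop :=
  [/\ linear alpha, bijective alpha &
      forall u v, alpha (lie u v) = lie (alpha u) (alpha v)].

Definition lie_antiautomorphism (alpha : g -> g) : Prop :=
  [/\ linear alpha, bijective alpha &
      forall u v, alpha (lie u v) = lie (alpha v) (alpha u)].

Definition lie_center (z : g) : Prop := forall u : g, lie z u = 0.

End LieTheory.

(* L(gl_2), as 2 x 2 matrices over F[t, t^-1].  This is a type of its own, as
   it is a vector space over F, while a matrix type over F[t, t^-1] comes with
   scalars in F[t, t^-1]. *)
Definition loop_gl2 (F : fieldType) : Type := 'M[laurent F]_2.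

HB.instance Definition _ (F : fieldType) :=
  GRing.Zmodule.copy (loop_gl2 F) 'M[laurent F]_2.

Lemma mx_jacobi (R : comNzRingType) n (x y z : 'M[R]_n) :
  x *m (y *m z - z *m y) - (y *m z - z *m y) *m x +
  (y *m (z *m x - x *m z) - (z *m x - x *m z) *m y) +
  (z *m (x *m y - y *m x) - (x *m y - y *m x) *m z) = 0.
Proof.
rewrite !(mulmxBl, mulmxBr) !mulmxA.
move: (x *m y *m z) (x *m z *m y) (y *m x *m z) (y *m z *m x) (z *m x *m y)
  (z *m y *m x) => xyz xzy yxz yzx zxy zyx.
by apply/matrixP => i j; rewrite !mxE; ring.
Qed.

Section Mx2.
Variable R : Type.
Definition mx2 (a b c d : R) : 'M[R]_2 :=
  \matrix_(i, j) if i == 0 then if j == 0 then a else b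
                 else if j == 0 then c else d.

Lemma mx2E a b c d :
  (mx2 a b c d 0 0 = a) * (mx2 a b c d 0 1 = b) *
  (mx2 a b c d 1 0 = c) * (mx2 a b c d 1 1 = d).
Proof. by rewrite !mxE. Qed.
End Mx2.

Section LoopGl2.
Variable F : fieldType.
Implicit Types (x y z : loop_gl2 F) (a : F).

Lemma loop_gl2P x y :
  [/\ x 0 0 = y 0 0, x 0 1 = y 0 1, x 1 0 = y 1 0 & x 1 1 = y 1 1] -> x = y.
Proof.
case=> e00 e01 e10 e11; apply/matrixP => i j.
have ordE (k : 'I_2) : k = 0 \/ k = 1.
  by case: k => [[|[|//]] le]; [left | right]; apply: val_inj.
by case: (ordE i) => ->; case: (ordE j) => ->.
Qed.

Definition loop_scale a x : loop_gl2 F := map_mx (fun p : laurent F => a *: p) x.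

Lemma loop_scaleA a b x : loop_scale a (loop_scale b x) = loop_scale (a * b) x.
Proof. by apply/matrixP => i j; rewrite !mxE scalerA. Qed.
Lemma loop_scale1 : left_id 1 loop_scale.
Proof. by move=> x; apply/matrixP => i j; rewrite !mxE scale1r. Qed.
Lemma loop_scaleDr : right_distributive loop_scale +%R.
Proof. by move=> a x y; apply/matrixP => i j; rewrite !mxE scalerDr. Qed.
Lemma loop_scaleDl x : {morph loop_scale^~ x : a b / a + b}.
Proof. by move=> a b; apply/matrixP => i j; rewrite !mxE scalerDl. Qed.

HB.instance Definition _ := GRing.Zmodule_isLmodule.Build F (loop_gl2 F)
  loop_scaleA loop_scale1 loop_scaleDr loop_scaleDl.

Definition loop_lie x y : loop_gl2 F := x *m y - y *m x.

Lemma loop0E i j : (0 : loop_gl2 F) i j = 0. Proof. exact: mxE. Qed.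
Lemma loopDE x y i j : (x + y) i j = x i j + y i j. Proof. by rewrite mxE. Qed.
Lemma loopZE a x i j : (a *: x) i j = a *: x i j. Proof. by rewrite mxE. Qed.

Lemma loop_lieE x y i j : loop_lie x y i j =
  x i 0 * y 0 j + x i 1 * y 1 j - (y i 0 * x 0 j + y i 1 * x 1 j).
Proof.
have ord1E : lift ord0 ord0 = 1 :> 'I_2 by apply: val_inj.
by rewrite !mxE !big_ord_recl !big_ord0 ord1E !addr0.
Qed.

Lemma loop_scale_mul a x y : (a *: x : loop_gl2 F) *m y = a *: (x *m y : loop_gl2 F).
Proof.
apply/matrixP => i j; rewrite !mxE scaler_sumr.
by apply: eq_bigr => k _; rewrite mxE scalerAl.
Qed.

Lemma loop_mul_scale a x y : x *m (a *: y : loop_gl2 F) = a *: (x *m y : loop_gl2 F).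
Proof.
apply/matrixP => i j; rewrite !mxE scaler_sumr.
by apply: eq_bigr => k _; rewrite mxE scalerAr.
Qed.

Lemma loop_lie_linearl z a x y :
  loop_lie (a *: x + y) z = a *: loop_lie x z + loop_lie y z.
Proof.
rewrite /loop_lie mulmxDl mulmxDr loop_scale_mul loop_mul_scale.
by rewrite scalerBr opprD addrACA.
Qed.

Lemma loop_liexx x : loop_lie x x = 0. Proof. exact: subrr. Qed.

Lemma loop_lieC x y : loop_lie x y = - loop_lie y x.
Proof. by rewrite /loop_lie opprB. Qed.

Lemma loop_lie_linearr z a x y :
  loop_lie z (a *: x + y) = a *: loop_lie z x + loop_lie z y.
Proof.
by rewrite loop_lieC loop_lie_linearl (loop_lieC z x) (loop_lieC z y) scalerN opprD.
Qed.

Lemma loop_lie_jacobi x y z :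
  loop_lie x (loop_lie y z) + loop_lie y (loop_lie z x) +
  loop_lie z (loop_lie x y) = 0.
Proof.
exact: mx_jacobi.
Qed.

HB.instance Definition _ := Lmodule_isLieAlgebra.Build F (loop_gl2 F)
  loop_lie_linearl loop_lie_linearr loop_liexx loop_lie_jacobi.

Definition theta x : loop_gl2 F :=
  mx2 (linv (x 1 1)) (linv (x 1 0)) (linv (x 0 1)) (linv (x 0 0)).

Definition sigma x : loop_gl2 F :=
  mx2 (x 1 1) (x 1 0 * tpow F 1) (x 0 1 * tpow F (-1)) (x 0 0).

Definition dagger x : loop_gl2 F :=
  mx2 (linv (x 0 0)) (linv (x 1 0)) (linv (x 0 1)) (linv (x 1 1)).

Definition epsilon x : F := leval 1 (x 0 0) + leval 1 (x 1 1).

Lemma tpowNV : tpow F 1 * tpow F (-1) = 1.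
Proof. by rewrite -tpowD. Qed.

Lemma lieE x y i j : lie x y i j =
  x i 0 * y 0 j + x i 1 * y 1 j - (y i 0 * x 0 j + y i 1 * x 1 j).
Proof. exact: loop_lieE. Qed.

Lemma theta_linear : linear theta.
Proof.
move=> a x y; apply: loop_gl2P.
by split; rewrite loopDE loopZE /theta !mx2E loopDE loopZE linvD linvZ.
Qed.

Lemma thetaK : involutive theta.
Proof. by move=> x; apply: loop_gl2P; rewrite /theta !mx2E !linvK. Qed.

Lemma theta_automorphism : lie_automorphism theta.
Proof.
split; [exact: theta_linear | exact: inv_bij thetaK | move=> x y].
by apply: loop_gl2P; split; rewrite lieE /theta !mx2E lieE linvB !linvD !linvM; ring.
Qed.

Lemma sigma_linear : linear sigma.
Proof.
move=> a x y; apply: loop_gl2P.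
by split; rewrite loopDE loopZE /sigma !mx2E loopDE loopZE // mulrDl scalerAl.
Qed.

Lemma sigmaK : involutive sigma.
Proof.
move=> x; apply: loop_gl2P; rewrite /sigma !mx2E; split=> //.
  by ring: tpowNV.
by ring: tpowNV.
Qed.

Lemma sigma_automorphism : lie_automorphism sigma.
Proof.
split; [exact: sigma_linear | exact: inv_bij sigmaK | move=> x y].
by apply: loop_gl2P; split; rewrite lieE /sigma !mx2E lieE; ring: tpowNV.
Qed.

Lemma dagger_linear : linear dagger.
Proof.
move=> a x y; apply: loop_gl2P.
by split; rewrite loopDE loopZE /dagger !mx2E loopDE loopZE linvD linvZ.
Qed.

Lemma daggerK : involutive dagger.
Proof. by move=> x; apply: loop_gl2P; rewrite /dagger !mx2E !linvK. Qed.

Lemma dagger_antiautomorphism : lie_antiautomorphism dagger.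
Proof.
split; [exact: dagger_linear | exact: inv_bij daggerK | move=> x y].
by apply: loop_gl2P; split; rewrite lieE /dagger !mx2E lieE linvB !linvD !linvM; ring.
Qed.

Lemma theta_sigma x : theta (sigma x) = sigma (theta x).
Proof.
by apply: loop_gl2P; rewrite /theta /dagger /sigma !mx2E !linvM !linv_tpow ?opprK.
Qed.

Lemma theta_dagger x : theta (dagger x) = dagger (theta x).
Proof. by apply: loop_gl2P; rewrite /theta /dagger !mx2E. Qed.

Lemma sigma_dagger x : sigma (dagger x) = dagger (sigma x).
Proof.
by apply: loop_gl2P; rewrite /theta /dagger /sigma !mx2E !linvM !linv_tpow ?opprK.
Qed.

Lemma epsilon_linear a x y : epsilon (a *: x + y) = a * epsilon x + epsilon y.
Proof. by rewrite /epsilon !loopDE !loopZE !levalD !levalZ mulrDr addrACA. Qed.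

Lemma epsilon_lie x y : epsilon (lie x y) = 0.
Proof.
rewrite /epsilon -levalD !lieE (_ : _ + _ = 0) ?leval0 //; ring.
Qed.

Lemma epsilon_sigma x : epsilon (sigma x) = epsilon x.
Proof. by rewrite /epsilon /sigma !mx2E addrC. Qed.

Lemma epsilon_dagger x : epsilon (dagger x) = epsilon x.
Proof. by rewrite /epsilon /dagger !mx2E !leval1_linv. Qed.

Definition calL : {pred loop_gl2 F} := fun x => epsilon x == 0.

Definition calO : {pred loop_gl2 F} := fun x => (x \in calL) && (theta x == x).

Lemma calOP x : reflect (epsilon x = 0 /\ theta x = x) (x \in calO).
Proof. by apply: (iffP andP) => -[/eqP ? /eqP ?]; split=> //; apply/eqP. Qed.

Lemma calO_submod : GRing.submod_closed calO.
Proof.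
have theta0 : theta 0 = 0.
  by have := theta_linear (-1) 0 0; rewrite scaler0 addr0 scaleN1r addNr.
split=> [|a x y /calOP[ex tx] /calOP[ey ty]]; apply/calOP.
  by rewrite theta0 /epsilon !loop0E leval0 addr0.
by rewrite epsilon_linear theta_linear ex ey tx ty mulr0 addr0.
Qed.

HB.instance Definition _ := GRing.isSubmodClosed.Build F (loop_gl2 F) calO calO_submod.

Lemma calO_lie x y : x \in calO -> y \in calO -> lie x y \in calO.
Proof.
move=> /calOP[_ tx] /calOP[_ ty]; apply/calOP; rewrite epsilon_lie.
by case: theta_automorphism => _ _ ->; rewrite tx ty.
Qed.

Lemma calO_sigma x : x \in calO -> sigma x \in calO.
Proof. by move=> /calOP[ex tx]; apply/calOP; rewrite epsilon_sigma theta_sigma tx. Qed.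

Lemma calO_dagger x : x \in calO -> dagger x \in calO.
Proof. by move=> /calOP[ex tx]; apply/calOP; rewrite epsilon_dagger theta_dagger tx. Qed.

End LoopGl2.

(* The Lie algebra O, the subalgebra [calO] of L(gl_2) as a type. *)
Definition algO (F : fieldType) : Type := {x : loop_gl2 F | x \in @calO F}.

Section AlgO.
Variable F : fieldType.
Implicit Types (x y z : algO F).

HB.instance Definition _ := SubChoice.on (algO F).
HB.instance Definition _ := [SubChoice_isSubLmodule of algO F by <:].

Definition lieO x y : algO F := Sub (lie (val x) (val y)) (calO_lie (valP x) (valP y)).

Lemma lieO_linearl z (a : F) x y : lieO (a *: x + y) z = a *: lieO x z + lieO y z.
Proof. by apply: val_inj; rewrite /= lie_linearl. Qed.
Lemma lieO_linearr z (a : F) x y : lieO z (a *: x + y) = a *: lieO z x + lieO z y.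
Proof. by apply: val_inj; rewrite /= lie_linearr. Qed.
Lemma lieOxx x : lieO x x = 0.
Proof. by apply: val_inj; rewrite /= liexx. Qed.
Lemma lieO_jacobi x y z : lieO x (lieO y z) + lieO y (lieO z x) + lieO z (lieO x y) = 0.
Proof. by apply: val_inj; rewrite /= lie_jacobi. Qed.

HB.instance Definition _ := Lmodule_isLieAlgebra.Build F (algO F)
  lieO_linearl lieO_linearr lieOxx lieO_jacobi.

Definition sigmaO x : algO F := Sub (sigma (val x)) (calO_sigma (valP x)).

Definition daggerO x : algO F := Sub (dagger (val x)) (calO_dagger (valP x)).

Lemma sigmaO_automorphism : lie_automorphism sigmaO.
Proof.
have [sl _ sm] := sigma_automorphism F.
split=> [a x y||x y]; [|apply: inv_bij => x|]; apply: val_inj => /=.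
- exact: sl.
- exact: sigmaK.
- exact: sm.
Qed.

Lemma daggerO_antiautomorphism : lie_antiautomorphism daggerO.
Proof.
have [sl _ sm] := dagger_antiautomorphism F.
split=> [a x y||x y]; [|apply: inv_bij => x|]; apply: val_inj => /=.
- exact: sl.
- exact: daggerK.
- exact: sm.
Qed.

End AlgO.

(* Main.v *)
Require Import Defs.
From mathcomp Require Import all_boot all_order all_algebra.
From mathcomp Require Import finmap.
From mathcomp.multinomials Require Import monalg.
Local Open Scope ring_scope.

Import GRing.Theory Num.Theory.

(** A central element of O is a scalar matrix whose diagonal entry is a Laurent
polynomial invariant under t |-> t^-1, and sigma and dagger visibly fix such a
matrix.  To see that it has this form, two elements of O suffice, namely the
antidiagonal matrices with entries t^n, t^-n for n = 0 and n = 1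
([antidiag_calO]).  Commuting with them gives a = d and b = c for n = 0, then
b t^-1 = c t for n = 1.  Hence b t^2 = b, and a Laurent polynomial, having
finite support, cannot be nonzero and invariant under a nontrivial shift
([lmul_tpow_fix_eq0]).  The symmetry of the diagonal entry is the condition of
being fixed by theta. *)

Lemma coef_mul_tpow {F : fieldType} (p : laurent F) (n k : int) :
  (p * tpow F n)@_k = p@_(k - n).
Proof.
elim/laurent_ind: p => [|p q IHp IHq|c m].
- by rewrite mul0r !mcoeff0.
- by rewrite mulrDl !mcoeffD IHp IHq.
by rewrite [_ * _]lmul_mon mulr1 !coef_lmon eq_sym -subr_eq eq_sym.
Qed.

(** The support of [p] would contain the infinite progression k + n i as soon
as it contains k. *)
Lemma lmul_tpow_fix_eq0 {F : fieldType} (p : laurent F) (n : int) :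
  n != 0 -> p * tpow F n = p -> p = 0.
Proof.
move=> n0 pn; apply/malgP => k; rewrite mcoeff0; apply/eqP.
case: eqVneq => // pk0.
have coef_shift i : p@_(k + n *+ i) = p@_k.
  elim: i => [|i IHi]; first by rewrite addr0.
  by rewrite -{1}pn coef_mul_tpow mulrSr addrA addrK.
pose s := [seq k + n *+ i | i <- iota 0 (size (msupp p)).+1].
have s_uniq : uniq s.
  rewrite map_inj_uniq ?iota_uniq // => i j /addrI /eqP.
  by rewrite -[n *+ i]mulr_natr -[n *+ j]mulr_natr (inj_eq (mulfI n0)) eqr_nat => /eqP.
have s_supp : {subset s <= msupp p}.
  by move=> _ /mapP[i _ ->]; rewrite -mcoeff_neq0 coef_shift.
by have := uniq_leq_size s_uniq s_supp; rewrite size_map size_iota ltnn.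
Qed.

Definition antidiag {F : fieldType} (n : int) : loop_gl2 F :=
  mx2 0 (tpow F n) (tpow F (- n)) 0.

Lemma antidiag_calO {F : fieldType} (n : int) : antidiag n \in @calO F.
Proof.
apply/calOP; split; first by rewrite /epsilon !mx2E leval0 addr0.
by apply: loop_gl2P; rewrite /theta !mx2E !linv_tpow opprK linv0.
Qed.

Lemma lie_center_scalar {F : fieldType} {z : algO F} : lie_center z ->
  [/\ val z 0 1 = 0, val z 1 0 = 0, val z 1 1 = val z 0 0 &
      linv (val z 0 0) = val z 0 0].
Proof.
move=> hz; have /calOP[_ theta_z] := valP z.
have commE n i j : lie (val z) (antidiag n) i j = 0.
  have /(congr1 val) /= comm_n := hz (Sub (antidiag n) (antidiag_calO n)).
  by rewrite comm_n loop0E.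
have ad : val z 1 1 = val z 0 0.
  have := commE 0 0 1; rewrite lieE !mx2E tpow0.
  rewrite !(mulr0, mul0r, mulr1, mul1r, addr0, add0r).
  by move/eqP; rewrite subr_eq0 => /eqP.
have bc : val z 0 1 = val z 1 0.
  have := commE 0 0 0; rewrite lieE !mx2E oppr0 tpow0.
  rewrite !(mulr0, mul0r, mulr1, mul1r, addr0, add0r).
  by move/eqP; rewrite subr_eq0 => /eqP.
have b0 : val z 0 1 = 0.
  apply: (lmul_tpow_fix_eq0 _ 2) => //.
  have := commE 1 0 0; rewrite lieE !mx2E -bc.
  rewrite !(mulr0, mul0r, addr0, add0r) => /eqP.
  rewrite subr_eq0 => /eqP b_shift.
  by rewrite (tpowD F 1 1) mulrA (mulrC (val z 0 1)) -b_shift -mulrA -tpowD mulr1.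
split=> //; first by rewrite -bc.
by rewrite -{2}theta_z /theta mx2E ad.
Qed.

Theorem lemma4p10 (F : fieldType) (charF0 : [pchar F] =i pred0)
    (z : algO F) (hz : lie_center z) :
  sigmaO z = z /\ daggerO z = z.
Proof.
have [b0 c0 da a_inv] := lie_center_scalar hz.
split; apply: val_inj; apply: loop_gl2P => /=.
  by rewrite /sigma !mx2E b0 c0 da !mul0r.
by rewrite /dagger !mx2E b0 c0 da linv0 a_inv.
Qed.
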